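(* (Type $q$-P$(A_7)$.) Let $A(x,t)$ be the matrix of the context and let $Y(x,t)={}^t(y_1(x),y_2(x))$ satisfy $Y(qx,t)=A(x,t)Y(x,t)$. Then $\det A(x,t)=\kappa_1\kappa_2x^3$, the eigenvalues of $A(0,t)$ are $\theta_1t,0$, and $y_1(x)$ satisfies the single $q$-difference equation $$y_1(q^2x)-\frac{q^2\kappa_1x^3-b_2x^2+b_1x-\lambda\theta_1t}{x-\lambda}y_1(qx)+\frac{\kappa_1\kappa_2x^3(qx-\lambda)}{x-\lambda}y_1(x)=0,$$ where $$b_2=q(q+1)\kappa_1\lambda-q^2\kappa_1\kappa_2\mu+\frac{q\theta_1t}{\lambda}-\frac{\lambda}{\mu},\qquad b_1=q\kappa_1\lambda^2-q\kappa_1\kappa_2\mu\lambda+(q+1)\theta_1t-\frac{\lambda^2}{\mu}.$$ Set $\mu=\frac{\lambda^2}{q\theta_1t}(1+d\lambda)$. As $\lambda\to0$, we have $$y_1(q^2x)-(q^2\kappa_1x^2-q\theta_1t\,d\,x+\theta_1t)y_1(qx)+q\kappa_1\kappa_2x^3y_1(x)=0.$$ Let $u(x)$ be a function which satisfies $u(qx)=xu(x)$ and set $f(x)=y_1(qx)/u(qx)$. Then the function $f(x)$ satisfies $$qxf(qx)-(q^2\kappa_1x^2-q\theta_1t\,d\,x+\theta_1t)f(x)+q\kappa_1\kappa_2x^2f(x/q)=0.$$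
   Context: Here $q,t,\kappa_1,\kappa_2,\theta_1,\lambda,\mu,\omega,d$ are parameters, and $$A(x,t)=\begin{pmatrix}\kappa_1\{(x-\lambda)(x-\alpha)+\mu_1\}&\omega(x-\lambda)\\ \kappa_1\omega^{-1}(\gamma x+\delta)&\kappa_2(x-\lambda)+\mu_2\end{pmatrix},$$ $$\mu_1=\frac{\lambda^2}{q\kappa_1\mu},\quad \mu_2=q\kappa_1\kappa_2\mu\lambda,\quad \alpha=\frac{\lambda^{-1}(\theta_1t-\kappa_1\mu_1-\mu_2)+\kappa_2}{\kappa_1},$$ $$\gamma=\mu_2-\kappa_2(2\lambda+\alpha),\quad \delta=\lambda^{-1}(\alpha\lambda+\mu_1)(\kappa_2\lambda-\mu_2).$$ This is the linear system of Murata's Lax form for the $q$-Painlevé equation of type $A_7$; $\lambda,\mu$ are the dependent variables of that $q$-Painlevé equation with respect to $t$, here treated as parameters. *)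

(* Defs.v *)
From HB Require Import structures.
From mathcomp Require Import all_boot all_order all_algebra.
From mathcomp Require Import complex.
From mathcomp Require Import all_classical all_reals all_analysis.

Set Implicit Arguments.
Unset Strict Implicit.
Unset Printing Implicit Defensive.

Import Order.TTheory GRing.Theory Num.Theory.
Import numFieldNormedType.Exports.

Local Open Scope classical_set_scope.
Local Open Scope ring_scope.

(* The complex numbers, packed as a numFieldType: MathComp-Analysis equips
   the carrier of a packed numFieldType, but not R[i] itself, with the topology
   of the modulus. *)
Definition Cplx (R : realType) : numFieldType := R[i]%C.

Section QPA7.
Context (K : fieldType).

Definition lax_mu1 (q kappa1 lambda mu : K) := lambda ^+ 2 / (q * kappa1 * mu).

Definition lax_mu2 (q kappa1 kappa2 lambda mu : K) :=
  q * kappa1 * kappa2 * mu * lambda.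

Definition lax_alpha (q t kappa1 kappa2 theta1 lambda mu : K) :=
  (lambda^-1 * (theta1 * t - kappa1 * lax_mu1 q kappa1 lambda mu
                - lax_mu2 q kappa1 kappa2 lambda mu) + kappa2) / kappa1.

Definition lax_gamma (q t kappa1 kappa2 theta1 lambda mu : K) :=
  lax_mu2 q kappa1 kappa2 lambda mu
  - kappa2 * (2 * lambda + lax_alpha q t kappa1 kappa2 theta1 lambda mu).

Definition lax_delta (q t kappa1 kappa2 theta1 lambda mu : K) :=
  lambda^-1
  * (lax_alpha q t kappa1 kappa2 theta1 lambda mu * lambda
     + lax_mu1 q kappa1 lambda mu)
  * (kappa2 * lambda - lax_mu2 q kappa1 kappa2 lambda mu).

Definition mx2 (a b c e : K) : 'M[K]_2 :=
  \matrix_(i < 2, j < 2)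
    if i == 0 then (if j == 0 then a else b) else (if j == 0 then c else e).

Definition laxA (q t kappa1 kappa2 theta1 lambda mu omega x : K) : 'M[K]_2 :=
  mx2
    (kappa1 * ((x - lambda) * (x - lax_alpha q t kappa1 kappa2 theta1 lambda mu)
               + lax_mu1 q kappa1 lambda mu))
    (omega * (x - lambda))
    (kappa1 * omega^-1 * (lax_gamma q t kappa1 kappa2 theta1 lambda mu * x
                          + lax_delta q t kappa1 kappa2 theta1 lambda mu))
    (kappa2 * (x - lambda) + lax_mu2 q kappa1 kappa2 lambda mu).

Definition eqn_b2 (q t kappa1 kappa2 theta1 lambda mu : K) :=
  q * (q + 1) * kappa1 * lambda - q ^+ 2 * kappa1 * kappa2 * mu
  + q * theta1 * t / lambda - lambda / mu.

Definition eqn_b1 (q t kappa1 kappa2 theta1 lambda mu : K) :=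
  q * kappa1 * lambda ^+ 2 - q * kappa1 * kappa2 * mu * lambda
  + (q + 1) * theta1 * t - lambda ^+ 2 / mu.

(* The single equation is y(q^2 x) - eqn_coef1 * y(q x) + eqn_coef0 * y(x) = 0. *)
Definition eqn_coef1 (q t kappa1 kappa2 theta1 lambda mu x : K) :=
  (q ^+ 2 * kappa1 * x ^+ 3 - eqn_b2 q t kappa1 kappa2 theta1 lambda mu * x ^+ 2
   + eqn_b1 q t kappa1 kappa2 theta1 lambda mu * x - lambda * theta1 * t)
  / (x - lambda).

Definition eqn_coef0 (q kappa1 kappa2 lambda x : K) :=
  kappa1 * kappa2 * x ^+ 3 * (q * x - lambda) / (x - lambda).

(* The value of mu imposed before letting lambda tend to 0. *)
Definition mu_lim (q t theta1 d lambda : K) :=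
  lambda ^+ 2 / (q * theta1 * t) * (1 + d * lambda).

End QPA7.

(* Main.v *)
Require Import Defs.
From HB Require Import structures.
From mathcomp Require Import all_boot all_order all_algebra.
From mathcomp Require Import complex.
From mathcomp Require Import all_classical all_reals all_analysis.
From mathcomp Require Import ring.
Import Order.TTheory GRing.Theory Num.Theory.
Import numFieldNormedType.Exports.
Local Open Scope classical_set_scope.
Local Open Scope ring_scope.

(** The statements about [A] and the single equation come down to identities of rational functions
    in the parameters: [det_laxA], the trace of [A 0] in [char_poly_laxA0], and the elimination of
    the second component in [laxA_single_eqn]. The analytic content is the limit [lambda -> 0].
    Along the prescribed [mu], of order [lambda ^+ 2], the singular terms of [eqn_b2] cancel and
    [eqn_b1] stays bounded, so both coefficients of the equation converge for each fixed [x]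
    ([cvg_eqn_coef1], [cvg_eqn_coef0]). Uniqueness of limits then carries the equation over to
    limits of solutions ([single_eqn_limit]). The last equation is the limit equation divided by
    [u (q * x) = x * u x] ([gauge_single_eqn]). *)

Lemma det_mx22E {S : comNzRingType} (A : 'M[S]_2) :
  \det A = A 0 0 * A 1 1 - A 0 1 * A 1 0.
Proof.
rewrite (expand_det_row _ 0) big_ord_recl big_ord1 /cofactor !det_mx11 !mxE /=.
have -> : lift 0 0 = 1 :> 'I_2 by apply/val_inj.
have -> : lift 1 0 = 0 :> 'I_2 by apply/val_inj.
by rewrite /= expr0 expr1; ring.
Qed.

Lemma char_poly_mx2 {K : fieldType} (a b c e : K) :
  char_poly (mx2 a b c e) = 'X^2 - (a + e) *: 'X + (a * e - b * c)%:P.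
Proof.
rewrite /char_poly det_mx22E !mxE /= -mul_polyC !polyCD polyCN !polyCM.
by rewrite !mulr0n !mulr1n; ring.
Qed.

Section LaxPair.
Context {K : fieldType} (q t kappa1 kappa2 theta1 lambda mu omega : K).
Hypotheses (q0 : q != 0) (kappa10 : kappa1 != 0).
Hypotheses (lambda0 : lambda != 0) (mu0 : mu != 0) (omega0 : omega != 0).
Let A := laxA q t kappa1 kappa2 theta1 lambda mu omega.

(** [lax_gamma] cancels the coefficient of [x ^+ 2] and [lax_delta] the constant one; the linear
    coefficient then vanishes because [mu1 * mu2 = kappa2 * lambda ^+ 3]. *)
Lemma det_laxA x : \det (A x) = kappa1 * kappa2 * x ^+ 3.
Proof.
rewrite det_mx22E !mxE /= /lax_delta /lax_gamma /lax_alpha /lax_mu1 /lax_mu2.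
by field; rewrite q0 kappa10 lambda0 mu0 omega0.
Qed.

(** The determinant vanishes at [x = 0], and [lax_alpha] is exactly the value that makes the trace
    of [A 0] equal to [theta1 * t]. *)
Lemma char_poly_laxA0 :
  char_poly (A 0) = ('X - (theta1 * t)%:P) * ('X - 0%:P).
Proof.
have := det_laxA 0; rewrite det_mx22E !mxE /= => detA0.
rewrite char_poly_mx2 detA0 expr0n mulr0 polyC0 addr0.
have -> : kappa1 * ((0 - lambda) * (0 - lax_alpha q t kappa1 kappa2 theta1 lambda mu)
             + lax_mu1 q kappa1 lambda mu)
          + (kappa2 * (0 - lambda) + lax_mu2 q kappa1 kappa2 lambda mu)
        = theta1 * t.
  rewrite /lax_alpha /lax_mu1 /lax_mu2.
  by field; rewrite q0 kappa10 lambda0 mu0.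
by rewrite -mul_polyC; ring.
Qed.

Lemma eigenvalue_laxA0 a : eigenvalue (A 0) a <-> a = theta1 * t \/ a = 0.
Proof.
rewrite eigenvalue_root_char char_poly_laxA0 rootM !root_XsubC.
by split=> [/orP[] /eqP|[]] ->; rewrite ?eqxx ?orbT; [left|right| |].
Qed.

(* y_2 is eliminated by solving the first row of the system for it, which is
   possible as long as the off-diagonal entry omega (x - lambda) is nonzero. *)
Lemma laxA_single_eqn (Y : K -> 'cV[K]_2) x :
  Y (q * x) = A x *m Y x -> Y (q * (q * x)) = A (q * x) *m Y (q * x) ->
  x != lambda ->
  Y (q ^+ 2 * x) 0 0
  - eqn_coef1 q t kappa1 kappa2 theta1 lambda mu x * Y (q * x) 0 0
  + eqn_coef0 q kappa1 kappa2 lambda x * Y x 0 0 = 0.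
Proof.
move=> Yqx Yqqx xl; have xl0 : x - lambda != 0 by rewrite subr_eq0.
have rowE M (v : 'cV[K]_2) i : (M *m v) i 0 = M i 0 * v 0 0 + M i 1 * v 1 0.
  rewrite mxE big_ord_recl big_ord1.
  by have -> : lift 0 0 = 1 :> 'I_2 by apply/val_inj.
have y1q : Y (q * x) 0 0 = A x 0 0 * Y x 0 0 + A x 0 1 * Y x 1 0.
  by rewrite Yqx rowE.
have y2q : Y (q * x) 1 0 = A x 1 0 * Y x 0 0 + A x 1 1 * Y x 1 0.
  by rewrite Yqx rowE.
(* Everything is now linear in the two components of [Y x]; the coefficients of both vanish
   identically. *)
rewrite expr2 -mulrA Yqqx rowE y2q y1q !mxE /=.
rewrite /eqn_coef1 /eqn_coef0 /eqn_b1 /eqn_b2.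
rewrite /lax_delta /lax_gamma /lax_alpha /lax_mu1 /lax_mu2.
by field; rewrite q0 kappa10 lambda0 mu0 omega0 xl0.
Qed.

End LaxPair.

Section Confluence.
Context {K : numFieldType} (q t kappa1 kappa2 theta1 d : K).
Hypotheses (q0 : q != 0) (theta1t0 : theta1 * t != 0).
Let mu := mu_lim q t theta1 d.

(* The poles of b_2 at lambda = 0 cancel: with this mu,
   q theta1 t / lambda - lambda / mu = q theta1 t d / (1 + d lambda). *)
Lemma eqn_b2_mu_lim lambda : lambda != 0 -> 1 + d * lambda != 0 ->
  eqn_b2 q t kappa1 kappa2 theta1 lambda (mu lambda) =
  q * (q + 1) * kappa1 * lambda - q ^+ 2 * kappa1 * kappa2 * mu lambda
  + q * theta1 * t * d / (1 + d * lambda).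
Proof.
move=> l0 dl0; move: theta1t0; rewrite mulf_eq0 negb_or => /andP[th0 t0].
by rewrite /eqn_b2 /mu /mu_lim; field; rewrite q0 th0 t0 l0 dl0.
Qed.

(** Here [lambda ^+ 2 / mu] has no pole at [lambda = 0]. It tends to [q * theta1 * t], which reduces
    [(q + 1) * theta1 * t] to [theta1 * t] in the limit. *)
Lemma eqn_b1_mu_lim lambda : lambda != 0 -> 1 + d * lambda != 0 ->
  eqn_b1 q t kappa1 kappa2 theta1 lambda (mu lambda) =
  q * kappa1 * lambda ^+ 2 - q * kappa1 * kappa2 * mu lambda * lambda
  + (q + 1) * theta1 * t - q * theta1 * t / (1 + d * lambda).
Proof.
move=> l0 dl0; move: theta1t0; rewrite mulf_eq0 negb_or => /andP[th0 t0].
by rewrite /eqn_b1 /mu /mu_lim; field; rewrite q0 th0 t0 l0 dl0.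
Qed.

Let cvg_lambda : (lambda @[lambda --> (0 : K)^'] --> (0 : K)).
Proof. exact: nbhs_dnbhs. Qed.

Let cvg_1d : 1 + d * lambda @[lambda --> (0 : K)^'] --> (1 : K).
Proof.
rewrite -[X in _ --> X]addr0 -[X in _ --> _ + X](mulr0 d).
by apply: cvgD; [exact: cvg_cst | apply: cvgM; [exact: cvg_cst |]].
Qed.

Let cvg_1dV : (1 + d * lambda)^-1 @[lambda --> (0 : K)^'] --> (1 : K).
Proof.
by rewrite -[X in _ --> X]invr1; apply: cvgV; [exact: oner_neq0 |].
Qed.

Let near_1d : \forall lambda \near (0 : K)^', 1 + d * lambda != 0.
Proof. by apply: (cvgr_neq0 _ cvg_1d); exact: oner_neq0. Qed.

Lemma cvg_mu_lim : mu lambda @[lambda --> (0 : K)^'] --> (0 : K).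
Proof.
have e0 : 0 ^+ 2 / (q * theta1 * t) * (1 + d * 0) = 0 :> K.
  by rewrite expr0n !mul0r.
rewrite -[X in _ --> X]e0.
apply: cvgM; last by apply: cvgD; [exact: cvg_cst | apply: cvgM; [exact: cvg_cst |]].
by apply: cvgM; [rewrite expr2; apply: cvgM | exact: cvg_cst].
Qed.

Lemma cvg_eqn_b2 :
  eqn_b2 q t kappa1 kappa2 theta1 lambda (mu lambda) @[lambda --> (0 : K)^']
  --> q * theta1 * t * d.
Proof.
(* The pole-free form holds on a punctured neighbourhood of 0, which is all the limit sees. *)
apply: cvg_trans; first apply: near_eq_cvg.
  near=> lambda; symmetry; apply: eqn_b2_mu_lim; near: lambda => //.
  exact: nbhs_dnbhs_neq.
(* The limit is written as the pole-free form with [lambda] and [mu] replaced by 0 and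
   [(1 + d * lambda)^-1] by 1, so that convergence can be proved term by term. *)
have limE : q * (q + 1) * kappa1 * 0 - q ^+ 2 * kappa1 * kappa2 * 0
    + q * theta1 * t * d * 1 = q * theta1 * t * d by ring.
rewrite -[X in _ `=>` nbhs X]limE.
apply: cvgD; last by apply: cvgM; [exact: cvg_cst | exact: cvg_1dV].
by apply: cvgB; apply: cvgM; [exact: cvg_cst | | exact: cvg_cst | exact: cvg_mu_lim].
Unshelve. all: by end_near. Qed.

Lemma cvg_eqn_b1 :
  eqn_b1 q t kappa1 kappa2 theta1 lambda (mu lambda) @[lambda --> (0 : K)^']
  --> theta1 * t.
Proof.
apply: cvg_trans; first apply: near_eq_cvg.
  near=> lambda; symmetry; apply: eqn_b1_mu_lim; near: lambda => //.
  exact: nbhs_dnbhs_neq.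
have -> : theta1 * t =
    q * kappa1 * 0 ^+ 2 - q * kappa1 * kappa2 * 0 * 0
    + (q + 1) * theta1 * t - q * theta1 * t * 1 by ring.
apply: cvgB; last by apply: cvgM; [exact: cvg_cst | exact: cvg_1dV].
apply: cvgD; last exact: cvg_cst.
apply: cvgB; last first.
  by apply: cvgM; [apply: cvgM; [exact: cvg_cst | exact: cvg_mu_lim] |].
by apply: cvgM; [exact: cvg_cst | rewrite expr2; apply: cvgM].
Unshelve. all: by end_near. Qed.

Let cvg_xB x : x != 0 -> (x - lambda)^-1 @[lambda --> (0 : K)^'] --> x^-1.
Proof.
move=> x0; apply: cvgV => //; rewrite -[X in _ --> X]subr0.
by apply: cvgB; [exact: cvg_cst |].
Qed.

(* At x = 0 the coefficient is the constant theta1 t for every lambda != 0,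
   so the limit also holds there. *)
Lemma cvg_eqn_coef1 x :
  eqn_coef1 q t kappa1 kappa2 theta1 lambda (mu lambda) x
    @[lambda --> (0 : K)^']
  --> q ^+ 2 * kappa1 * x ^+ 2 - q * theta1 * t * d * x + theta1 * t.
Proof.
have [->|x0] := eqVneq x 0.
  apply: cvg_trans; first apply: near_eq_cvg.
    near=> lambda; symmetry; rewrite /eqn_coef1.
    have l0 : lambda != 0 by near: lambda; exact: nbhs_dnbhs_neq.
    have -> : (q ^+ 2 * kappa1 * 0 ^+ 3
      - eqn_b2 q t kappa1 kappa2 theta1 lambda (mu lambda) * 0 ^+ 2
      + eqn_b1 q t kappa1 kappa2 theta1 lambda (mu lambda) * 0
      - lambda * theta1 * t) / (0 - lambda) = theta1 * t by field.
    by [].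
  have -> : q ^+ 2 * kappa1 * 0 ^+ 2 - q * theta1 * t * d * 0 + theta1 * t
     = theta1 * t by ring.
  exact: cvg_cst.
(* For [x != 0] the limit is put back over the denominator [x], the limit of [x - lambda], to match
   the quotient defining the coefficient. *)
have -> : q ^+ 2 * kappa1 * x ^+ 2 - q * theta1 * t * d * x + theta1 * t =
    (q ^+ 2 * kappa1 * x ^+ 3 - q * theta1 * t * d * x ^+ 2
     + theta1 * t * x - 0 * theta1 * t) / x by field.
apply: cvgM; last exact: cvg_xB.
apply: cvgB; last first.
  by apply: cvgM; [apply: cvgM; [|exact: cvg_cst] | exact: cvg_cst].
apply: cvgD; last by apply: cvgM; [exact: cvg_eqn_b1 | exact: cvg_cst].
apply: cvgB; first exact: cvg_cst.
by apply: cvgM; [exact: cvg_eqn_b2 | exact: cvg_cst].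
Unshelve. all: by end_near. Qed.

(** For [x != 0] the quotient [(q * x - lambda) / (x - lambda)] tends to [q]; at [x = 0] the factor
    [x ^+ 3] makes both sides zero. *)
Lemma cvg_eqn_coef0 x :
  eqn_coef0 q kappa1 kappa2 lambda x @[lambda --> (0 : K)^']
  --> q * kappa1 * kappa2 * x ^+ 3.
Proof.
have [->|x0] := eqVneq x 0.
  under eq_fun do rewrite /eqn_coef0 expr0n mulr0 !mul0r.
  by rewrite expr0n mulr0; exact: cvg_cst.
have -> : q * kappa1 * kappa2 * x ^+ 3 =
    kappa1 * kappa2 * x ^+ 3 * (q * x - 0) / x by field.
apply: cvgM; last exact: cvg_xB.
apply: cvgM; first exact: cvg_cst.
by apply: cvgB; [exact: cvg_cst |].
Qed.

(** The left-hand side converges to the limit expression and is zero near 0, so that expression is 0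
    by uniqueness of limits. With [x] fixed, the three values of the solution enter as functions of
    [lambda] alone. *)
Lemma single_eqn_limit (x y1x y1qx y1q2x : K) (y0 yq yq2 : K -> K) :
  (\forall lambda \near (0 : K)^',
     yq2 lambda
     - eqn_coef1 q t kappa1 kappa2 theta1 lambda (mu lambda) x * yq lambda
     + eqn_coef0 q kappa1 kappa2 lambda x * y0 lambda = 0) ->
  y0 lambda @[lambda --> (0 : K)^'] --> y1x ->
  yq lambda @[lambda --> (0 : K)^'] --> y1qx ->
  yq2 lambda @[lambda --> (0 : K)^'] --> y1q2x ->
  y1q2x
  - (q ^+ 2 * kappa1 * x ^+ 2 - q * theta1 * t * d * x + theta1 * t) * y1qx
  + q * kappa1 * kappa2 * x ^+ 3 * y1x = 0.
Proof.
move=> eqn c0 cq cq2.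
have lim := cvgD (cvgB cq2 (cvgM (cvg_eqn_coef1 x) cq)) (cvgM (cvg_eqn_coef0 x) c0).
apply: (cvg_unique (@norm_hausdorff _ K) (lim _ _ _ _)).
apply: cvg_trans; first apply: near_eq_cvg; last exact: (cvg_cst (0 : K)).
by near=> lambda; symmetry; near: lambda.
Unshelve. all: by end_near. Qed.

End Confluence.

Lemma gauge_single_eqn {K : fieldType} (q kappa1 kappa2 c x : K)
    (y1 u f : K -> K) :
  q != 0 -> x != 0 -> u x != 0 ->
  y1 (q ^+ 2 * x) - c * y1 (q * x) + q * kappa1 * kappa2 * x ^+ 3 * y1 x = 0 ->
  u (q * x) = x * u x -> u (q * (q * x)) = q * x * u (q * x) ->
  (forall z, f z = y1 (q * z) / u (q * z)) ->
  q * x * f (q * x) - c * f x + q * kappa1 * kappa2 * x ^+ 2 * f (x / q) = 0.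
Proof.
move=> q0 x0 ux0 eqn uqx uqqx fE.
rewrite !fE [q * (x / q)]mulrCA divff // mulr1 uqqx uqx [q * (q * x)]mulrA -expr2.
(* By the two relations for [u], [u (q * (q * x)) = q * x ^+ 2 * u x], so the claim is the given
   equation divided by [x * u x]. *)
transitivity ((y1 (q ^+ 2 * x) - c * y1 (q * x)
               + q * kappa1 * kappa2 * x ^+ 3 * y1 x) / (x * u x)).
  by field; rewrite q0 x0 ux0.
by rewrite eqn mul0r.
Qed.

Theorem mainTheorem8 (R : realType) (q t kappa1 kappa2 theta1 d : Cplx R)
    (hq : q != 0) (hkappa1 : kappa1 != 0) :
  (* the linear system and its single q-difference equation *)
  (forall lambda mu omega : Cplx R,
      lambda != 0 -> mu != 0 -> omega != 0 ->
      let A := laxA q t kappa1 kappa2 theta1 lambda mu omega in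
      [/\ forall x, \det (A x) = kappa1 * kappa2 * x ^+ 3,
          forall a, eigenvalue (A 0) a <-> a = theta1 * t \/ a = 0,
          char_poly (A 0) = ('X - (theta1 * t)%:P) * ('X - 0%:P)
        & forall (D : set (Cplx R)) (Y : Cplx R -> 'cV[Cplx R]_2),
            (forall x, D x -> Y (q * x) = A x *m Y x) ->
            let y1 := fun x => Y x 0 0 in
            forall x, D x -> D (q * x) -> x != lambda ->
              y1 (q ^+ 2 * x)
              - eqn_coef1 q t kappa1 kappa2 theta1 lambda mu x * y1 (q * x)
              + eqn_coef0 q kappa1 kappa2 lambda x * y1 x = 0])
  /\
  (* lambda -> 0 along mu = lambda^2 / (q theta1 t) * (1 + d lambda) *)
  (theta1 * t != 0 ->
    let mu := mu_lim q t theta1 d in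
    [/\ forall x, eqn_coef1 q t kappa1 kappa2 theta1 lambda (mu lambda) x
                    @[lambda --> (0 : Cplx R)^']
                  --> q ^+ 2 * kappa1 * x ^+ 2 - q * theta1 * t * d * x
                      + theta1 * t,
        forall x, eqn_coef0 q kappa1 kappa2 lambda x @[lambda --> (0 : Cplx R)^']
                  --> q * kappa1 * kappa2 * x ^+ 3
      & forall (D : set (Cplx R)) (y : Cplx R -> Cplx R -> Cplx R)
               (y1 : Cplx R -> Cplx R),
          (forall x, D x -> \forall lambda \near (0 : Cplx R)^',
             y lambda (q ^+ 2 * x)
             - eqn_coef1 q t kappa1 kappa2 theta1 lambda (mu lambda) x
               * y lambda (q * x)
             + eqn_coef0 q kappa1 kappa2 lambda x * y lambda x = 0) ->
          (forall x, D x ->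
             [/\ y lambda x @[lambda --> (0 : Cplx R)^'] --> y1 x,
                 y lambda (q * x) @[lambda --> (0 : Cplx R)^'] --> y1 (q * x)
               & y lambda (q ^+ 2 * x) @[lambda --> (0 : Cplx R)^']
                   --> y1 (q ^+ 2 * x)]) ->
          forall x, D x ->
            y1 (q ^+ 2 * x)
            - (q ^+ 2 * kappa1 * x ^+ 2 - q * theta1 * t * d * x + theta1 * t)
              * y1 (q * x)
            + q * kappa1 * kappa2 * x ^+ 3 * y1 x = 0])
  /\
  (forall (D E : set (Cplx R)) (y1 u f : Cplx R -> Cplx R),
      (forall x, D x ->
         y1 (q ^+ 2 * x)
         - (q ^+ 2 * kappa1 * x ^+ 2 - q * theta1 * t * d * x + theta1 * t)
           * y1 (q * x)
         + q * kappa1 * kappa2 * x ^+ 3 * y1 x = 0) ->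
      (forall x, E x -> u (q * x) = x * u x) ->
      (forall x, f x = y1 (q * x) / u (q * x)) ->
      forall x, D x -> E x -> E (q * x) -> u x != 0 ->
        q * x * f (q * x)
        - (q ^+ 2 * kappa1 * x ^+ 2 - q * theta1 * t * d * x + theta1 * t) * f x
        + q * kappa1 * kappa2 * x ^+ 2 * f (x / q) = 0).
Proof.
split=> [lambda mu omega l0 m0 o0 A|]; last split.
- split=> [x|a||D Y eqY y1 x Dx Dqx xl].
  + exact: det_laxA.
  + exact: eigenvalue_laxA0.
  + exact: char_poly_laxA0.
  + by apply: (laxA_single_eqn _ _ _ _ _ _ _ omega) => //; exact: eqY.
- move=> th0 mu; split=> [x|x|D y y1 eqn cvgy x Dx].
  + exact: cvg_eqn_coef1.
  + exact: cvg_eqn_coef0.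
  + have [c0 cq cq2] := cvgy x Dx.
    exact: (single_eqn_limit q t kappa1 kappa2 theta1 d hq th0 x _ _ _ _ _ _
              (eqn x Dx) c0 cq cq2).
- move=> D E y1 u f eqn uq fE x Dx Ex Eqx ux0.
  (* At [x = 0] the relation for [u] would read [u 0 = 0], against [u x != 0]. *)
  have x0 : x != 0.
    apply: contraNneq ux0 => x0; move: (uq x Ex).
    by rewrite x0 mulr0 mul0r => ->.
  by apply: (gauge_single_eqn _ _ _ _ _ y1 u) => //; [exact: eqn | exact: uq | exact: uq].
Qed.
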